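(* Let $G=(V,E,s,t)$ be a directed multigraph with finite arc set $E$ and two distinguished vertices $s,t\in V$ (possibly equal). Let $V'$ be the set of nonsinks of $G$, let $\mathcal{PF}(G)$ be the path-free complex of $G$, and let $\widetilde{\chi}$ denote the reduced Euler characteristic. If $E\neq\varnothing$, then: (a) if $G$ contains a useless arc or a cycle, then $\widetilde{\chi}(\mathcal{PF}(G))=0$; (b) otherwise, $\widetilde{\chi}(\mathcal{PF}(G))=(-1)^{\#V'}$. If $E=\varnothing$, then $\widetilde{\chi}(\mathcal{PF}(G))$ equals $0$ if $s=t$ and $-1$ otherwise.
   Context: Graphs are directed multigraphs; each arc has a source and a target in $V$; parallel arcs and self-loops are allowed. A walk from $v_0$ to $v_n$ is a sequence $(v_0,e_1,v_1,\ldots,e_n,v_n)$ with $n\ge 0$, $v_i\in V$, $e_i\in E$, where each $e_i$ is an arc from $v_{i-1}$ to $v_i$. A path is a walk that does not visit any vertex more than once; an $s-t$-path is a path from $s$ to $t$ (if $s=t$, this is the trivial path with no arcs). A cycle is a walk with $n\ge1$, $v_0=v_n$ and $v_0,\ldots,v_{n-1}$ distinct (so a self-loop gives a cycle). A nonsink is a vertex that is the source of at least one arc. A useless arc is an arc that belongs to no $s-t$-path. A set $F\subseteq E$ contains a path if it contains every arc of it. A simplicial complex on a finite ground set $W$ is a set $\Delta$ of subsets of $W$ (its faces) closed under taking subsets; $\Delta=\varnothing$ is allowed, as is $\Delta=\{\varnothing\}$, and singletons need not be faces. The path-free complex is $\mathcal{PF}(G)=\{F\subseteq E : F \text{ contains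 no } s-t\text{-path}\}$, with ground set $E$. The reduced Euler characteristic is $\widetilde{\chi}(\Delta)=\sum_{I\in\Delta}(-1)^{\#I-1}$. *)

(* Defs.v *)
From HB Require Import structures.
From mathcomp Require Import all_boot all_order all_algebra.
From mathcomp Require Import boolp.

Set Implicit Arguments.
Unset Strict Implicit.
Unset Printing Implicit Defensive.

Import GRing.Theory.
Local Open Scope ring_scope.

(* The vertex set may be infinite; only the arc set is required to be finite. *)
Record digraph := Digraph {
  vertex : eqType;
  arcs : finType;
  src : arcs -> vertex;
  tgt : arcs -> vertex;
  s_of : vertex;
  t_of : vertex
}.

Section Walks.
Variable G : digraph.
Implicit Types (u v w : vertex G) (e : arcs G) (p : seq (arcs G)).

(* The walk (v_0, e_1, v_1, ..., e_n, v_n) is encoded by its starting vertex   *)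
(* v_0 and its arcs p = [:: e_1; ...; e_n], since v_i is the target of e_i.   *)
Fixpoint is_walk u p v : bool :=
  if p is e :: p' then (src e == u) && is_walk (tgt e) p' v else u == v.

Definition walk_vertices u p : seq (vertex G) := u :: [seq tgt e | e <- p].

Definition is_path u p v : bool := is_walk u p v && uniq (walk_vertices u p).

Definition is_st_path p : bool := is_path (s_of G) p (t_of G).

(* [belast u [:: v_1; ...; v_n]] is [:: v_0; ...; v_(n-1)] with v_0 = u. *)
Definition is_cycle u p : bool :=
  [&& p != [::], is_walk u p u & uniq (belast u [seq tgt e | e <- p])].

Definition has_cycle : Prop := exists u p, is_cycle u p.

Definition useless e : Prop := ~ exists p, is_st_path p /\ e \in p.

Definition has_useless_arc : Prop := exists e, useless e.

Definition nonsinks : seq (vertex G) := undup [seq src e | e : arcs G].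

Lemma mem_nonsinks v : (v \in nonsinks) = [exists e, src e == v].
Proof.
rewrite mem_undup; apply/imageP/existsP => [[e _ ->]|[e /eqP <-]].
  by exists e.
by exists e.
Qed.

Definition contains_st_path (F : {set arcs G}) : Prop :=
  exists p, is_st_path p /\ {subset p <= F}.

End Walks.

Record simplicial_complex (W : finType) := SimplicialComplex {
  faces :> {set {set W}};
  facesS : forall A B : {set W}, A \subset B -> B \in faces -> A \in faces
}.

(* The exponent is an integer, so the empty face contributes (-1) ^ (-1) = -1. *)
Definition reduced_euler (W : finType) (D : simplicial_complex W) : int :=
  \sum_(I in faces D) (-1) ^ (#|I|%:Z - 1).

Definition path_free_faces (G : digraph) : {set {set arcs G}} :=
  [set F : {set arcs G} | `[< ~ contains_st_path F >]].

Lemma path_free_facesS (G : digraph) (A B : {set arcs G}) :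
  A \subset B -> B \in path_free_faces G -> A \in path_free_faces G.
Proof.
move=> /subsetP sAB; rewrite !inE => /asboolP nB; apply/asboolP => -[p [pp pA]].
by apply: nB; exists p; split=> // e /pA /sAB.
Qed.

Definition path_free_complex (G : digraph) : simplicial_complex (arcs G) :=
  SimplicialComplex (@path_free_facesS G).

(* Main.v *)
(* Since the alternating sum over all arc sets vanishes when there is an arc,
   the reduced Euler characteristic equals the sum of (-1)^|F| over the arc sets
   F in which t is reachable from s.  More generally, let P(S, A) be this sum over
   F contained in A, with a set S of starting vertices in place of s.  For an arc
   e : u -> v of A with u in S,
     P(S, A) = P(S, A - e) - P(S + v, A - e),
   and P(S, A) = 0 as soon as some arc of A can be toggled without effect (for
   example, an arc entering S).
   If A has a cycle, then either some arc enters S, or the cycle avoids the arcs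
   leaving S and survives in A - e; so P(S, A) = 0 by induction.
   If there is no cycle and no useless arc, processing the vertices in
   topological order shows that each target of an arc contributes a factor -1;
   the targets are t and the nonsinks other than s. *)
Require Import Defs.
From HB Require Import structures.
From mathcomp Require Import all_boot all_order all_algebra.
From mathcomp Require Import boolp.

Import GRing.Theory.
Local Open Scope ring_scope.

Set Implicit Arguments.
Unset Strict Implicit.
Unset Printing Implicit Defensive.

(** * Alternating sums over families of subsets *)

Section SignedSums.
Variable T : finType.
Implicit Types (A F : {set T}) (Q : pred {set T}) (e : T).

(** The exponent is not shifted by one, so for a complex this is minus its reduced Euler
    characteristic. *)
Definition signed_sum A Q : int := \sum_(F : {set T} | (F \subset A) && Q F) (-1) ^+ #|F|.

Lemma eq_signed_sum A Q Q' :
  (forall F, F \subset A -> Q F = Q' F) -> signed_sum A Q = signed_sum A Q'.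
Proof.
move=> eqQ; apply: eq_bigl => F.
by case sFA: (F \subset A) => //=; rewrite eqQ.
Qed.

Lemma signed_sum_pred0 A Q : (forall F, F \subset A -> ~~ Q F) -> signed_sum A Q = 0.
Proof.
move=> nQ; apply: big_pred0 => F.
by case sFA: (F \subset A) => //=; apply/negbTE/nQ.
Qed.

Lemma signed_sum_set0 Q : signed_sum set0 Q = (Q set0)%:R.
Proof.
rewrite /signed_sum (eq_bigl (fun F => (F == set0) && Q F)) => [|F]; last first.
  by rewrite subset0.
rewrite big_mkcondr big_pred1_eq cards0 expr0.
by case: (Q set0).
Qed.

(** The sets avoiding [e] give the first term; deleting [e] from the others flips their sign. *)
Lemma signed_sum_split A Q e : e \in A ->
  signed_sum A Q = signed_sum (A :\ e) Q - signed_sum (A :\ e) (fun F => Q (e |: F)).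
Proof.
move=> eA; rewrite /signed_sum (bigID (fun F => e \in F)) /= addrC; congr (_ + _).
  apply: eq_bigl => F; rewrite subsetD1.
  by rewrite -!andbA; congr (_ && _); rewrite andbC.
rewrite -sumrN (reindex_onto (fun F => e |: F) (fun F => F :\ e)) /=; last first.
  by move=> F /andP[_ eF]; rewrite setD1K.
apply: eq_big => [F|F /andP[_ /eqP eqF]].
  rewrite subUset sub1set eA setU11 andbT /= subsetD1.
  case eF: (e \in F).
    rewrite /= andbF /=; apply/negbTE/negP => /andP[_ /eqP eqF].
    by move: eF; rewrite -eqF !inE eqxx.
  by rewrite setU1K ?eF // eqxx !andbT.
have eF : e \notin F by rewrite -eqF !inE eqxx.
by rewrite cardsU1 eF exprS mulN1r.
Qed.

(** [F] and [e |: F] cancel in pairs. *)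
Lemma signed_sum_toggle A Q e : e \in A ->
  (forall F, F \subset A :\ e -> Q (e |: F) = Q F) -> signed_sum A Q = 0.
Proof.
move=> eA tog; rewrite (signed_sum_split _ eA).
by rewrite (eq_signed_sum (Q := fun F => Q (e |: F)) (Q' := Q)) ?subrr.
Qed.

End SignedSums.

(** * Reachability, walks and paths *)

Section Reachability.
Variable G : digraph.
Implicit Types (u v w : vertex G) (e a b : arcs G) (p : seq (arcs G)).
Implicit Types (S L : seq (vertex G)) (A C F : {set arcs G}).

(** Distinctness of vertices is not imposed, so that adding arcs or starting vertices is handled by
    plain induction; [reach_path] recovers paths. *)
Inductive reach S F : vertex G -> Prop :=
| reach_start v : v \in S -> reach S F v
| reach_step e : e \in F -> reach S F (src e) -> reach S F (tgt e).

Lemma reach_subset S F F' v : F \subset F' -> reach S F v -> reach S F' v.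
Proof.
move=> sFF'; elim=> [w wS|e eF _ IH]; first exact: reach_start.
by apply: reach_step IH; apply: (subsetP sFF').
Qed.

Lemma not_reach S F v :
  v \notin S -> (forall e, e \in F -> tgt e != v) -> ~ reach S F v.
Proof.
move=> vS vF rv; case: rv vS vF => [w -> //|e eF _ _ /(_ e eF)].
by rewrite eqxx.
Qed.

(** The source of [e] is already reached, so having [e] amounts to starting at its target as
    well. *)
Lemma reach_add_arc S F e v : src e \in S ->
  reach S (e |: F) v <-> reach (tgt e :: S) F v.
Proof.
move=> eS; split; elim=> [w wS|a].
- by apply: reach_start; rewrite inE wS orbT.
- rewrite in_setU1 => /orP[/eqP-> _ _|aF _ IH].
    by apply: reach_start; rewrite mem_head.
  exact: reach_step.
- move: wS; rewrite inE => /orP[/eqP->|wS]; last exact: reach_start.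
  by apply: reach_step; [rewrite setU11 | apply: reach_start].
- by move=> aF _ IH; apply: reach_step IH; rewrite in_setU1 aF orbT.
Qed.

Lemma reach_add_entering S F e v : tgt e \in S ->
  reach S (e |: F) v <-> reach S F v.
Proof.
move=> eS; split; last by apply: reach_subset; rewrite subsetUr.
elim=> [w wS|a]; first exact: reach_start.
rewrite in_setU1 => /orP[/eqP-> _ _|aF _ IH]; first exact: reach_start.
exact: reach_step.
Qed.

(** A first use of [e] would have to reach its source through [F] alone. *)
Lemma reach_add_unreached S F e v : ~ reach S F (src e) ->
  reach S (e |: F) v <-> reach S F v.
Proof.
move=> ne; split; last by apply: reach_subset; rewrite subsetUr.
elim=> [w wS|a]; first exact: reach_start.
by rewrite in_setU1 => /orP[/eqP-> _ /ne|aF _ IH] //; apply: reach_step.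
Qed.

Lemma is_walk_cat u p1 p2 v :
  is_walk u (p1 ++ p2) v <-> exists2 w, is_walk u p1 w & is_walk w p2 v.
Proof.
elim: p1 u => [|e p1 IH] u /=.
  by split=> [H|[w /eqP->]//]; exists u.
split=> [/andP[-> /IH[w p1w p2v]]|[w /andP[-> p1w] p2v]].
  by exists w; rewrite ?p1w.
by apply/IH; exists w.
Qed.

Lemma is_walk_last u p v : is_walk u p v -> last u [seq tgt e | e <- p] = v.
Proof. by elim: p u => [|e p IH] u /= => [/eqP|/andP[_ /IH]]. Qed.

Lemma mem_walk_src u p v e : is_walk u p v -> e \in p ->
  src e \in walk_vertices u p.
Proof.
elim: p u => [//|a p IH] u /= /andP[/eqP au pv]; rewrite inE => /orP[/eqP->|ep].
  by rewrite au mem_head.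
by rewrite inE (IH _ pv ep) orbT.
Qed.

Lemma walk_end_tgt u p v : p != [::] -> is_walk u p v -> v \in [seq tgt e | e <- p].
Proof. by case: p => [//|e p] _ /is_walk_last /= <-; rewrite mem_last. Qed.

Lemma walk_reach S F u p v :
  is_walk u p v -> {subset p <= F} -> reach S F u -> reach S F v.
Proof.
elim: p u => [|e p IH] u /= => [/eqP<- //|/andP[/eqP<- pv] pF ru].
apply: (IH _ pv) => [a ap|]; first by apply: pF; rewrite inE ap orbT.
by apply: reach_step ru; apply: pF; rewrite mem_head.
Qed.

Lemma path_prefix u p w v : is_path u p w -> v \in walk_vertices u p ->
  exists2 p', is_path u p' v & {subset p' <= p}.
Proof.
case/andP=> pw Up; rewrite inE => /orP[/eqP->|/mapP[e ep ->]].
  by exists [::]; rewrite // /is_path /= eqxx.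
case/splitPr: ep pw Up => p1 p2; rewrite -cat_rcons => /is_walk_cat[x p1x _] Up.
exists (rcons p1 e) => [|a]; last by rewrite mem_cat => ->.
rewrite /is_path; apply/andP; split.
  by have := is_walk_last p1x; rewrite map_rcons last_rcons => ->.
by move: Up; rewrite /walk_vertices map_cat -cat_cons cat_uniq => /andP[].
Qed.

(** A path is extended arc by arc; when the new target was already visited, the path is cut back to
    that visit instead. *)
Lemma reach_path u F v : reach [:: u] F v ->
  exists2 p, is_path u p v & {subset p <= F}.
Proof.
elim=> [w|e eF _ [p pe pF]].
  by rewrite inE => /eqP->; exists [::]; rewrite // /is_path /= eqxx.
case vp: (tgt e \in walk_vertices u p).
  by have [p' p'e p'p] := path_prefix pe vp; exists p' => // a /p'p /pF.
exists (rcons p e) => [|a]; last by rewrite mem_rcons inE => /orP[/eqP->|/pF].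
case/andP: pe => pe Up; rewrite /is_path; apply/andP; split.
  by rewrite -cats1; apply/is_walk_cat; exists (src e); rewrite //= !eqxx.
by rewrite /walk_vertices map_rcons -rcons_cons rcons_uniq vp.
Qed.

Lemma contains_st_path_reach F :
  contains_st_path F <-> reach [:: s_of G] F (t_of G).
Proof.
split=> [[p [/andP[pw _] pF]]|/reach_path[p pst pF]]; last by exists p.
by apply: (walk_reach pw pF); apply: reach_start; rewrite mem_head.
Qed.

(** A path from the target of [e] back to its source, preceded by [e], is a cycle. *)
Lemma reach_back_cycle e : reach [:: tgt e] setT (src e) -> has_cycle G.
Proof.
case/reach_path=> p /andP[pw Up] _; exists (src e), (e :: p).
rewrite /is_cycle /= eqxx pw /=.
by move: Up; rewrite /walk_vertices lastI (is_walk_last pw) rcons_uniq.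
Qed.

End Reachability.

(** * The alternating sum over arc sets that connect the starting vertices to [t] *)

Section Domination.
Variable G : digraph.
Implicit Types (v w : vertex G) (e a b : arcs G) (p : seq (arcs G)).
Implicit Types (S L : seq (vertex G)) (A C F : {set arcs G}).
Local Notation s := (s_of G).
Local Notation t := (t_of G).

Definition reach_sum S A : int := signed_sum A (fun F => `[< reach S F t >]).

Lemma reach_sum_toggle S A e : e \in A ->
  (forall F, F \subset A :\ e -> reach S (e |: F) t <-> reach S F t) ->
  reach_sum S A = 0.
Proof.
by move=> eA tog; apply: (signed_sum_toggle eA) => F /tog; apply: asbool_equiv_eq.
Qed.

Lemma reach_sum_split S A e : e \in A -> src e \in S ->
  reach_sum S A = reach_sum S (A :\ e) - reach_sum (tgt e :: S) (A :\ e).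
Proof.
move=> eA eS; rewrite /reach_sum (signed_sum_split _ eA); congr (_ - _).
by apply: eq_signed_sum => F _; apply: asbool_equiv_eq; apply: reach_add_arc.
Qed.

(* The arcs of a cycle form a set [C] as below; no further property of cycles is
   needed. *)
Lemma reach_sum_cyclic S A C : C != set0 -> C \subset A ->
  (forall c, c \in C -> exists2 d, d \in C & tgt d = src c) ->
  reach_sum S A = 0.
Proof.
move=> C0 sCA Ccyc; have [n] := ubnP #|A|.
elim: n => // n IH in S A sCA *; rewrite ltnS => ltAn.
(* An arc entering [S] never affects reachability. *)
have [|noent] := boolP [exists e in A, tgt e \in S].
  case/exists_inP=> e eA eS; apply: (reach_sum_toggle eA) => F _.
  exact: reach_add_entering.
(* If [t] is a starting vertex, every arc can be toggled, and [C] supplies one. *)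
have [tS|tS] := boolP (t \in S).
  have [c cC] := set0Pn _ C0.
  apply: (reach_sum_toggle (subsetP sCA c cC)) => F _.
  by split=> _; apply: reach_start.
have [|noexit] := boolP [exists e in A, src e \in S].
  case/exists_inP=> e eA eS.
  (* If [e] were in [C], its predecessor in [C] would enter [S]. *)
  have sCAe : C \subset A :\ e.
    rewrite subsetD1 sCA /=; apply/negP => /Ccyc[d dC de].
    case/negP: noent; apply/exists_inP; exists d; first exact: (subsetP sCA).
    by rewrite de.
  have ltAe : (#|A :\ e| < n)%N by move: ltAn; rewrite (cardsD1 e A) eA.
  by rewrite (reach_sum_split eA eS) !IH ?subrr.
(* No arc of [A] leaves [S], so only vertices of [S] are reached, and [t] is not one of them. *)
apply: signed_sum_pred0 => F sFA; apply/asboolPn => rt.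
suff: t \in S by apply/negP.
elim: rt => // e eF _ eS; case/negP: noexit.
by apply/exists_inP; exists e => //; apply: (subsetP sFA).
Qed.

(* [h] is a topological order in which [t] comes last, and [L] lists the targets
   of the arcs of [A]. *)
Lemma reach_sum_acyclic S A L (h : vertex G -> nat) :
  (forall e, e \in A -> h (src e) < h (tgt e))%N ->
  (forall e, e \in A -> tgt e != t -> h (tgt e) < h t)%N ->
  uniq L -> (forall v, v \in L <-> exists2 e, e \in A & tgt e = v) ->
  t \in L -> (forall v, v \in L -> v \notin S) ->
  (forall e, e \in A -> src e \in S ++ L) ->
  (forall v, v \in L -> v != t -> exists2 e, e \in A & src e = v) ->
  reach_sum S A = (-1) ^+ size L.
Proof.
have [n] := ubnP #|A|.
elim: n => // n IH in S A L *; rewrite ltnS => ltAn h1 h2 UL LE tL LS srcA Lsrc.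
have [e0 e0A _] := (LE t).1 tL.
(* Processing starts with an arc whose target is lowest in the order. *)
have [e eA emin] : exists2 e, e \in A & forall a, a \in A -> (h (tgt e) <= h (tgt a))%N.
  by case: (arg_minnP (fun e => h (tgt e)) e0A) => e; exists e.
(* Otherwise the source of [a] would lie in [L], as an arc target lower than the minimum. *)
have inS a : a \in A -> tgt a = tgt e -> src a \in S.
  move=> aA ae; have := srcA a aA; rewrite mem_cat => /orP[//|/LE[b bA ba]].
  by have := h1 a aA; rewrite -ba ae ltnNge emin.
have eS : src e \in S by apply: inS.
have eL : tgt e \in L by apply/LE; exists e.
have etS := LS _ eL.
have ltAe : (#|A :\ e| < n)%N by move: ltAn; rewrite (cardsD1 e A) eA.
have sub a : a \in A :\ e -> a \in A by rewrite inE => /andP[].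
have Lsrc' v : v \in L -> v != t -> exists2 a, a \in A :\ e & src a = v.
  move=> vL vt; have [a aA av] := Lsrc v vL vt; exists a => //.
  rewrite !inE aA andbT; apply/eqP => ae.
  by have := LS v vL; rewrite -av ae eS.
rewrite (reach_sum_split eA eS).
(* If a second arc [a] has the same target, it enters the enlarged set of starting vertices and
   kills the second term; the first keeps the same [L]. *)
have [|alone] := boolP [exists a in A :\ e, tgt a == tgt e].
  case/exists_inP=> a aAe /eqP ae.
  have -> : reach_sum (tgt e :: S) (A :\ e) = 0.
    apply: (reach_sum_toggle aAe) => F _; apply: reach_add_entering.
    by rewrite ae mem_head.
  rewrite subr0; apply: IH => // [b /sub|b /sub|v|b /sub]; try by auto.
  split=> [/LE[b bA bv]|[b /sub bA bv]]; last by apply/LE; exists b.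
  have [be|be] := eqVneq b e; first by exists a; rewrite // -bv be.
  by exists b; rewrite // !inE be bA.
have {}alone a : a \in A :\ e -> tgt a != tgt e.
  by move=> aAe; apply: contra alone => ae; apply/exists_inP; exists a.
have unr F : F \subset A :\ e -> ~ reach S F (tgt e).
  by move=> sF; apply: not_reach etS _ => a /(subsetP sF) /alone.
(* If the lowest target is [t], all arcs of [A] end at [t], so [e] is the only one and the
   difference is 0 - 1. *)
have [et|et] := eqVneq (tgt e) t.
  have tgtA a : a \in A -> tgt a = t.
    move=> aA; apply/eqP; apply: contraT => at_.
    by have := h2 a aA at_; rewrite ltnNge -et emin.
  have -> : A :\ e = set0.
    apply/eqP; rewrite -subset0; apply/subsetP => a aAe.
    by have := alone a aAe; rewrite et tgtA ?eqxx // sub.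
  have -> : size L = 1%N.
    have /perm_size -> // : perm_eq L [:: t].
    apply: uniq_perm => // v; rewrite inE; apply/idP/eqP => [|-> //].
    by case/LE=> a /tgtA ->.
  rewrite /reach_sum !signed_sum_set0.
  rewrite asboolF; last by rewrite -et; apply: unr; rewrite sub0set.
  rewrite asboolT; last by apply: reach_start; rewrite et mem_head.
  by [].
(* Without [e] its target is unreachable, so an arc leaving that target can be toggled. *)
have -> : reach_sum S (A :\ e) = 0.
  have [b bAe be] := Lsrc' _ eL et.
  apply: (reach_sum_toggle bAe) => F sF; apply: reach_add_unreached.
  by rewrite be; apply: unr; apply: subset_trans sF (subsetDl _ _).
(* In the surviving term the target of [e] moves from [L] to the starting vertices, at the cost of a
   factor -1. *)
have szL : size L = (size (rem (tgt e) L)).+1.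
  by rewrite size_rem // prednK //; case: (L) eL.
rewrite sub0r szL exprS mulN1r; congr (- _).
apply: IH => //.
- by move=> b /sub; auto.
- by move=> b /sub; auto.
- exact: rem_uniq.
- move=> v; rewrite mem_rem_uniq // inE; split.
    case/andP=> ve /LE[a aA av]; exists a => //; rewrite !inE aA andbT.
    by apply: contra_neq ve => <-; rewrite av.
  case=> a aAe av; rewrite -av /= [_ != _]alone //=.
  by apply/LE; exists a => //; apply: sub.
- by rewrite mem_rem_uniq // inE eq_sym et.
- by move=> v; rewrite mem_rem_uniq // !inE negb_or => /andP[-> /LS].
- move=> a /sub /srcA; rewrite !mem_cat inE mem_rem_uniq // inE.
  by case: (src a == _) => //=.
- by move=> v; rewrite mem_rem_uniq // inE => /andP[_ vL]; apply: Lsrc'.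
Qed.

(** The faces are the complementary family, and the shift of the exponent by one flips the sign. The
    sum over all arc sets is kept because it is 1 when there are no arcs. *)
Lemma reduced_eulerE :
  reduced_euler (path_free_complex G) =
    signed_sum setT (fun F : {set arcs G} => `[< contains_st_path F >])
    - signed_sum [set: arcs G] predT.
Proof.
have sumT (Q : pred {set arcs G}) : signed_sum setT Q = \sum_(F | Q F) (-1) ^+ #|F|.
  by apply: eq_bigl => F; rewrite subsetT.
rewrite !sumT [X in _ - X](bigID (fun F => `[< contains_st_path F >])) /=.
rewrite opprD addrA subrr sub0r -sumrN.
apply: eq_big => F; first by rewrite inE asbool_neg.
by move=> _; rewrite exprzDr // mulrN1.
Qed.

End Domination.

(** * Useless arcs, and graphs in which every arc lies on an [s]-[t]-path *)

Section UsefulArcs.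
Variable G : digraph.
Implicit Types (v w : vertex G) (e a b : arcs G) (p : seq (arcs G)).
Local Notation s := (s_of G).
Local Notation t := (t_of G).

(** No [s]-[t]-path uses [e], so [e] can be toggled. *)
Lemma signed_sum_useless e : useless e ->
  signed_sum setT (fun F : {set arcs G} => `[< contains_st_path F >]) = 0.
Proof.
move=> ue; apply: (signed_sum_toggle (in_setT e)) => F _.
apply: asbool_equiv_eq; split=> -[p [pst pF]]; exists p; split=> // a ap.
  have := pF a ap; rewrite in_setU1 => /orP[/eqP ae|//].
  by case: ue; exists p; rewrite -ae.
by rewrite in_setU1 pF ?orbT.
Qed.

Hypothesis useful : forall e, exists2 p, is_st_path p & e \in p.

Lemma useful_source e : src e = s \/ exists a, tgt a = src e.
Proof.
have [p /andP[pw _] ep] := useful e.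
have := mem_walk_src pw ep; rewrite inE => /orP[/eqP|/mapP[a _ ->]]; first by left.
by right; exists a.
Qed.

Lemma useful_target e : tgt e = t \/ exists a, src a = tgt e.
Proof.
have [p /andP[pw _] ep] := useful e.
case/splitPr: ep pw => p1 p2 /is_walk_cat[w _ /= /andP[_]].
by case: p2 => [/eqP|a p2 /= /andP[/eqP ae _]]; [left | right; exists a].
Qed.

Lemma useful_target_neq e : tgt e != s.
Proof.
have [p /andP[_ /= /andP[sp _]] ep] := useful e.
by apply: contraNneq sp => <-; apply: map_f.
Qed.

(** A path through [e] visits [t] after traversing [e], so it cannot have visited [t] before. *)
Lemma useful_source_neq e : src e != t.
Proof.
have [p /andP[pw Up] ep] := useful e.
case/splitPr: ep pw Up => p1 p2 /is_walk_cat[w p1w p2t].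
rewrite /walk_vertices map_cat -cat_cons cat_uniq => /and3P[_ /hasPn dis _].
have tp2 := walk_end_tgt (isT : e :: p2 != [::]) p2t.
have := dis t tp2; apply: contraNneq => <-.
case/andP: p2t => /eqP-> _.
by rewrite -(is_walk_last p1w) mem_last.
Qed.

Lemma useful_reach e : reach [:: tgt e] setT t.
Proof.
have [p /andP[pw _] ep] := useful e.
case/splitPr: ep pw => p1 p2 /is_walk_cat[w _ /= /andP[_ p2t]].
apply: (walk_reach p2t) => [a _|]; first by rewrite in_setT.
by apply: reach_start; rewrite mem_head.
Qed.

Lemma useful_end e : (exists a, src a = s) /\ (exists a, tgt a = t).
Proof.
have [p /andP[pw _] ep] := useful e.
have p0 : p != [::] by case: (p) ep.
split; last by have /mapP[a _ ->] := walk_end_tgt p0 pw; exists a.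
by case: p p0 pw {ep} => [//|a p] _ /= /andP[/eqP as_ _]; exists a.
Qed.

(** The arc [e] guarantees that some arc leaves [s] and some arc enters [t]. *)
Lemma useful_acyclic_sum e : ~ has_cycle G ->
  reach_sum [:: s] setT = (-1) ^+ size (nonsinks G).
Proof.
move=> acyc; have [[a as_] [b bt]] := useful_end e.
have sN : s \in nonsinks G by rewrite mem_nonsinks; apply/existsP; exists a; apply/eqP.
have UN : uniq (nonsinks G) by apply: undup_uniq.
have NE v : v \in nonsinks G <-> exists c, src c = v.
  rewrite mem_nonsinks; split=> [/existsP[c /eqP]|[c cv]]; first by exists c.
  by apply/existsP; exists c; apply/eqP.
have st : s != t by rewrite -bt eq_sym useful_target_neq.
(* These are the targets of arcs; trading [s] for [t] preserves the number of nonsinks. *)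
pose L := t :: rem s (nonsinks G).
have LN v : v \in L <-> v = t \/ v != s /\ v \in nonsinks G.
  rewrite inE mem_rem_uniq // inE.
  split=> [/orP[/eqP|/andP[]]|[->|[-> ->]]]; rewrite ?eqxx ?orbT; auto.
have -> : size (nonsinks G) = size L.
  by rewrite /= size_rem // prednK //; case: (nonsinks G) sN.
(* The number of arcs from whose target [v] can be reached serves as the topological order. *)
pose R v := [set c : arcs G | `[< reach [:: tgt c] setT v >]].
have hsrc c : (#|R (src c)| < #|R (tgt c)|)%N.
  apply/proper_card/properP; split.
    apply/subsetP => d; rewrite !inE => /asboolP rd; apply/asboolP.
    by apply: reach_step rd; rewrite in_setT.
  (* The arc [c] makes the inclusion strict: its target reaching its source would close a cycle. *)
  exists c; rewrite inE; first by apply/asboolP/reach_start; rewrite mem_head.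
  by apply/asboolPn => /reach_back_cycle.
have ht : R t = setT.
  by apply/setP => c; rewrite !inE; apply/asboolP/useful_reach.
apply: (reach_sum_acyclic (h := fun v => #|R v|)) => //.
(* A target other than [t] has an outgoing arc [d], along which the order increases strictly, and
   [R t] is the set of all arcs. *)
- move=> c _ ct; have [/eqP|[d dc]] := useful_target c; first by rewrite (negbTE ct).
  by rewrite -dc; apply: leq_trans (hsrc d) _; rewrite ht subset_leq_card ?subsetT.
- rewrite /= rem_uniq // andbT mem_rem_uniq // inE eq_sym st /=.
  by apply/negP => /NE[c /eqP]; apply/negP/useful_source_neq.
- move=> v; rewrite LN; split.
    case=> [->|[vs /NE[c cv]]]; first by exists b.
    have [cs|[d dc]] := useful_source c; first by rewrite -cv cs eqxx in vs.
    by exists d; rewrite // dc.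
  case=> c _ <-; have [|[d dc]] := useful_target c; first by left.
  by right; split; [apply: useful_target_neq | apply/NE; exists d].
- exact: mem_head.
- by move=> v /LN[->|[vs _]]; rewrite inE // eq_sym.
- move=> c _; rewrite mem_cat inE.
  have [//|cs] := eqVneq (src c) s; apply/LN; right; split=> //.
  by apply/NE; exists c.
- by move=> v /LN[->|[_ /NE[c cv]] _]; [rewrite eqxx | exists c].
Qed.

End UsefulArcs.

Theorem theorem1p4 (G : digraph) :
  (#|arcs G| <> 0%N ->
     (has_useless_arc G \/ has_cycle G ->
        reduced_euler (path_free_complex G) = 0) /\
     (~ (has_useless_arc G \/ has_cycle G) ->
        reduced_euler (path_free_complex G) = (-1) ^+ size (nonsinks G))) /\
  (#|arcs G| = 0%N ->
     reduced_euler (path_free_complex G) = if s_of G == t_of G then 0 else -1).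
Proof.
have reachE : signed_sum setT (fun F : {set arcs G} => `[< contains_st_path F >])
    = reach_sum [:: s_of G] [set: arcs G].
  by apply: eq_signed_sum => F _; apply/asbool_equiv_eq/contains_st_path_reach.
rewrite reduced_eulerE; split=> [/eqP|] E0.
  have [e _] : exists e, e \in arcs G by apply/card_gt0P; rewrite lt0n.
  have -> : signed_sum [set: arcs G] predT = 0.
    exact: (signed_sum_toggle (in_setT e)).
  rewrite subr0; split=> [[[a ua]|[u [p /and3P[p0 pw _]]]]|nuc].
  - exact: signed_sum_useless ua.
  (* [C] is the set of arcs of the cycle; the predecessor of the first arc is the last one. *)
  - rewrite reachE; apply: (@reach_sum_cyclic _ _ _ [set a in p]) (subsetT _) _.
      by case: p p0 {pw} => // a p _; apply/set0Pn; exists a; rewrite inE mem_head.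
    move=> c; rewrite inE => cp.
    have /mapP[d dp ->] : src c \in [seq tgt a | a <- p].
      have := mem_walk_src pw cp; rewrite inE => /orP[/eqP->|//].
      exact: walk_end_tgt pw.
    by exists d; rewrite ?inE.
  - rewrite reachE; apply: (useful_acyclic_sum _ e) => [a|cyc].
      apply: contrapT => na; apply: nuc; left; exists a => -[p [pst ap]].
      by apply: na; exists p.
    by apply: nuc; right.
have -> : [set: arcs G] = set0 by apply/eqP; rewrite -cards_eq0 cardsT E0.
rewrite !signed_sum_set0 /=.
(* Without arcs, only the trivial path can occur. *)
have -> : `[< contains_st_path (set0 : {set arcs G}) >] = (s_of G == t_of G).
  apply/asboolP/eqP => [[[|e p] [/andP[pw _] pF]]|st].
  - exact/eqP.
  - by have := pF e (mem_head _ _); rewrite inE.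
  - by exists [::]; split=> //; rewrite /is_st_path /is_path /= st eqxx.
(* The values are 1 - 1 and 0 - 1. *)
by case: (_ == _); rewrite ?subrr ?sub0r.
Qed.
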